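(* Let $P$ be a set of $m$ points in $\mathbb{R}^3$, let $t>0$, and let $\mathcal{C}$ be a $t$-shallow cutting of $P$. For any integer $d>0$ there exist a subset $P'\subseteq P$ and a set of three-dimensional boxes $\mathcal{R}=\{R_1,\dots,R_s\}$ such that: (a) $|P'|=O(m/d)$; (b) every $R_i$ is unbounded along the $z$-axis, i.e. has the form $[x_1,x_2]\times[y_1,y_2]\times(-\infty,+\infty)$; (c) for every cell $C_i$ of $\mathcal{C}$ there are $g=O(d^3)$ boxes $R_{i_1},\dots,R_{i_g}\in\mathcal{R}$ with $list(C_i)\cap(P\setminus P')\subseteq \bigcup_{j=1}^{g}(list(C_i)\cap R_{i_j})$; (d) each box of $\mathcal{R}$ contains $O(t\cdot d^4)$ points of $P$.
   Context: A $t$-shallow cutting of a set $P$ of $m$ points in $\mathbb{R}^3$ is a collection of $O(m/t)$ cells, each cell being a box of the form $[0,a]\times[0,b]\times[0,c]$, such that each cell contains at most $2t$ points of $P$ and every point $q\in\mathbb{R}^3$ that dominates at most $t$ points of $P$ is contained in some cell. (A point $q$ dominates $p$ if every coordinate of $p$ is at most the corresponding coordinate of $q$.) For a cell $C$, $list(C)=P\cap C$ is its conflict list. *)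

(* Defs.v *)
From mathcomp Require Import all_boot all_order all_algebra.
From mathcomp Require Import finmap reals.

Set Implicit Arguments.
Unset Strict Implicit.
Unset Printing Implicit Defensive.

Import Order.TTheory GRing.Theory Num.Theory.
Local Open Scope fset_scope.
Local Open Scope ring_scope.

Notation point R := (R * R * R)%type.

Notation box R := (interval R * interval R * interval R)%type.

Definition in_box (R : realType) (B : box R) (p : point R) : bool :=
  [&& p.1.1 \in B.1.1, p.1.2 \in B.1.2 & p.2 \in B.2].

Definition dominates (R : realType) (q p : point R) : bool :=
  [&& p.1.1 <= q.1.1, p.1.2 <= q.1.2 & p.2 <= q.2].

Definition box_points (R : realType) (P : {fset point R}) (B : box R) :
    {fset point R} :=
  [fset p in P | in_box B p].

Definition dominated_points (R : realType) (P : {fset point R})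
    (q : point R) : {fset point R} :=
  [fset p in P | dominates q p].

(* The side [0, a] of a cell, where a = +oo is allowed: a point with one      *)
(* sufficiently small coordinate dominates few points however large its other *)
(* coordinates are, so finitely many bounded cells could never contain all    *)
(* the points that dominate at most t points of P.                            *)
Definition anchored (R : realType) (I : interval R) : Prop :=
  I = `[0, +oo[ \/ exists2 a : R, 0 <= a & I = `[0, a].

Definition is_cell (R : realType) (B : box R) : Prop :=
  [/\ anchored B.1.1, anchored B.1.2 & anchored B.2].

(* k is the constant hidden in the bound O(m/t) on the number of cells. As    *)
(* cells lie in the nonnegative octant, the covering condition can only be    *)
(* imposed on the points q of that octant.                                    *)
Definition shallow_cutting (R : realType) (k t : R) (P : {fset point R})
    (C : {fset box R}) : Prop :=
  [/\ #|` C|%:R <= k * (#|` P|%:R / t),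
      forall B : box R, B \in C -> is_cell B,
      forall B : box R, B \in C -> #|` box_points P B|%:R <= 2 * t
    & forall q : point R, 0 <= q.1.1 -> 0 <= q.1.2 -> 0 <= q.2 ->
        #|` dominated_points P q|%:R <= t ->
        exists2 B : box R, B \in C & in_box B q].

Definition conflict_list (R : realType) (P : {fset point R}) (B : box R) :
    {fset point R} :=
  box_points P B.

Definition z_unbounded (R : realType) (B : box R) : Prop :=
  exists x1 x2 y1 y2 : R,
    [/\ x1 <= x2, y1 <= y2 & B = (`[x1, x2], `[y1, y2], `]-oo, +oo[)].

(* Main.v *)
Require Import Defs.
From mathcomp Require Import all_boot all_order all_algebra.
From mathcomp Require Import finmap reals.
From mathcomp Require Import lra.

Set Implicit Arguments.
Unset Strict Implicit.
Unset Printing Implicit Defensive.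

Import Order.TTheory GRing.Theory Num.Theory.

(* Keep only the cells that are maximal for inclusion and list them by          *)
(* decreasing height. Their xy-shadows are quadrants, and a point of cell i     *)
(* lies in every earlier cell h <= i whose quadrant contains its projection.    *)
(* Call a point fresh for the first quadrant that contains its projection. The  *)
(* fresh regions are disjoint, so at most m / (t d) of them hold more than t d  *)
(* points; the lists of those cells go to P'. Every other fresh region is a     *)
(* staircase, cut into one rectangle per quadrant it buries, plus one; the sum  *)
(* of these numbers is at most 2 |C|, since a quadrant is buried only once.     *)
(*                                                                              *)
(* A point of cell i, fresh for h, is found again from i as follows: go to      *)
(* nearest neighbours on the staircase, always to the left or always to the     *)
(* right, then descend from a quadrant to those it buried, down to h. All the   *)
(* cells on the way contain the point, so adding the list of any of them to P'  *)
(* breaks the route. Choosing O(|C| / d) such cells bounds the descents by d    *)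
(* rectangles (greedy cut of the burial forest) and the walks by d steps (depth *)
(* modulo d in the neighbour forests), which leaves O(d^2) rectangles for each  *)
(* cell, at the price of O(t |C| / d) = O(m / d) points.                        *)

(** With cells sorted by decreasing height, a point of cell [i] whose projection lies in an earlier
    quadrant [h] also lies in cell [h]. Heights can then be forgotten, and boxes unbounded in z
    suffice. The planar work is [planar_cover], resting on [forest_cut] for descents and on
    [walk_left_sample] for walks. By [step_convex] the points sharing a step label have their
    bounding rectangle inside one fresh region, so a box holds at most [t d] points once overfull
    regions are dropped. *)

Lemma ord_fixpoint (n : nat) (U : Type) (u0 : U)
    (F : 'I_n -> ('I_n -> U) -> U) :
    (forall (h : 'I_n) f g, (forall j : 'I_n, j < h -> f j = g j) ->
       F h f = F h g) ->
  exists f, forall h, f h = F h f.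
Proof.
move=> Fext; pose G k := iter k (fun f h => F h f) (fun=> u0).
have GS k h : G k.+1 h = F h (G k) by [].
(* The value at [h] is settled after [h + 1] rounds. *)
have stab m : forall (h : 'I_n) k l, h < m -> h < k -> h < l -> G k h = G l h.
  elim: m => // m IHm h [|k] [|l] // hm hk hl; rewrite !GS.
  apply: Fext => j jh; apply: IHm; exact: leq_trans jh _.
exists (G n) => h; rewrite -GS; exact: stab (ltn_ord h) (ltn_ord h) (leqW (ltn_ord h)).
Qed.

Lemma pigeonhole_mod (n d : nat) (f : 'I_n -> nat) : 0 < d ->
  exists2 r, r < d & d * #|[set i | f i %% d == r]| <= n.
Proof.
move=> d0; pose N (r : 'I_d) := #|[set i | f i %% d == r]|.
have Nn : \sum_r N r = n.
  rewrite -[RHS]card_ord -sum1_card.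
  rewrite (partition_big (fun i => Ordinal (ltn_pmod (f i) d0)) predT) //=.
  apply: eq_bigr => r _; rewrite /N -sum1_card; apply: eq_bigl => i.
  by rewrite inE.
pose r0 := Ordinal d0; have [r _ rmin] := arg_minnP N (isT : predT r0).
exists r => //; apply: leq_trans (eq_leq Nn).
rewrite -[X in X * _](card_ord d) -sum_nat_const.
by apply: leq_sum => j _; apply: rmin.
Qed.

Lemma card_bigcup_le (I U : finType) (A : {pred I}) (F : I -> {set U}) :
  #|\bigcup_(i in A) F i| <= \sum_(i in A) #|F i|.
Proof.
elim/big_rec2: _ => [|i m X _ le_X]; first by rewrite cards0.
by apply: leq_trans (leq_card_setU _ _) _; rewrite leq_add2l.
Qed.

(* Greedy cut: [acc h] is the weight that still hangs below [h] once every child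
   that has accumulated at least [H] is cut off. *)
Lemma forest_cut (n H : nat) (e : rel 'I_n) (w : 'I_n -> nat) :
    (forall h j : 'I_n, e h j -> j < h) ->
    (forall h h' j : 'I_n, e h j -> e h' j -> h = h') ->
  exists acc : 'I_n -> nat,
    (forall h, acc h = w h + \sum_(j | e h j && (acc j < H)) acc j) /\
    H * #|[set h | H <= acc h]| <= \sum_h w h.
Proof.
move=> e_lt e_uniq.
pose F (h : 'I_n) (f : 'I_n -> nat) := w h + \sum_(j | e h j && (f j < H)) f j.
have [|acc accE] := @ord_fixpoint n nat 0 F.
  move=> h f g fg; congr (_ + _); rewrite big_mkcond [RHS]big_mkcond.
  by apply: eq_bigr => j _; case ehj: (e h j) => //=; rewrite (fg _ (e_lt _ _ ehj)).
exists acc; split=> //.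
(* Each node has at most one parent, so it is counted at most once on the right; cancelling the
   light nodes bounds the heavy ones by the total weight. *)
have sum_acc : \sum_h acc h <= \sum_h w h + \sum_(j | acc j < H) acc j.
  rewrite (eq_bigr _ (fun h _ => accE h)) big_split leq_add2l /=.
  rewrite (exchange_big_dep (fun j => acc j < H)) => [|h j _ /andP[]//] /=.
  apply: leq_sum => j jH; rewrite sum_nat_const.
  rewrite -[X in _ <= X]mul1n leq_mul2r; apply/orP; right.
  apply/card_le1_eqP => h h' /andP[ehj _] /andP[eh'j _].
  exact: e_uniq eh'j ehj.
rewrite mulnC -sum_nat_const.
apply: (@leq_trans (\sum_(h in [set h | H <= acc h]) acc h)).
  by apply: leq_sum => h; rewrite inE.
move: sum_acc; rewrite (bigID (fun j => acc j < H)) /= addnC leq_add2r.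
by rewrite [X in _ -> X <= _](eq_bigl (fun h => ~~ (acc h < H))) // => h; rewrite inE leqNgt.
Qed.

(** * Walks along the staircase *)

Section StaircaseWalk.

Variables (disp : Order.disp_t) (T : orderType disp) (n : nat).
Variables (a b : 'I_n -> T).

Definition in_quad (i : 'I_n) (q : T * T) : bool :=
  (q.1 <= a i)%O && (q.2 <= b i)%O.

Definition quad_sub (j h : 'I_n) : bool := (a j <= a h)%O && (b j <= b h)%O.

(* Quadrants that are already buried need not be excluded: the one with the
   largest [a] contains all that quadrant [i] shares with the others. *)
Definition upper_left (i k : 'I_n) : bool :=
  [&& k < i, (a k < a i)%O & (b i < b k)%O].

Definition nearest_left (i : 'I_n) : 'I_n :=
  odflt i [pick k | upper_left i k &
                    [forall j, upper_left i j ==> (a j <= a k)%O]].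

(* [top i] stands for the quadrant containing [q] that is not buried at time [i]
   and under which the quadrant owning [q] is buried. *)
Record tracks (q : T * T) (top : 'I_n -> 'I_n) : Prop := Tracks {
  tracks_le : forall i, in_quad i q -> top i <= i;
  tracks_in : forall i, in_quad i q -> in_quad (top i) q;
  tracks_max : forall i, in_quad i q ->
    forall k : 'I_n, top i < k <= i -> ~~ quad_sub (top i) k;
  tracks_mono : forall i j : 'I_n, in_quad i q -> in_quad j q -> i <= j ->
    quad_sub (top i) (top j)
}.

Hypothesis antichain : forall i j : 'I_n, i < j -> ~~ quad_sub j i.

Lemma nearest_leftP i k : upper_left i k ->
  upper_left i (nearest_left i) /\ (a k <= a (nearest_left i))%O.
Proof.
move=> ik; rewrite /nearest_left; case: pickP => [j /andP[ij /forallP jmax]|no] /=.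
  by split=> //; apply: implyP ik.
have [j ij jmax] := arg_maxP a ik.
move/(_ j): no; rewrite ij /= => /negbT/forallPn[l].
by rewrite negb_imply => /andP[/jmax le_lj /negP[]]; apply: le_lj.
Qed.

(** If [top i] is not [i], it is upper left of [i]: [tracks_max] says that [i] does not contain it,
    the antichain that it does not contain [i]. So the nearest left quadrant still contains [q], and
    its own top lies inside [top i], which keeps the walk on the same side. *)
Lemma walk_left (depth : 'I_n -> nat) q top i :
    (forall h, depth h = if nearest_left h < h then (depth (nearest_left h)).+1
                         else 0) ->
    tracks q top -> in_quad i q -> (a (top i) <= a i)%O ->
  exists M, [/\ M <= depth i,
      top (iter M nearest_left i) = iter M nearest_left i &
      forall m, m <= M -> [/\ in_quad (iter m nearest_left i) q,
        iter m nearest_left i <= i &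
        depth (iter m nearest_left i) = depth i - m]].
Proof.
move=> depthE Q; have [N] := ubnP (i : nat); elim: N i => // N IHN i iN qi le_top.
have [topi | topNi] := eqVneq (top i) i.
  by exists 0; split=> // -[] // _; rewrite subn0.
have lt_top : top i < i.
  by rewrite ltn_neqAle (tracks_le Q qi) andbT; apply: contra topNi => /eqP/val_inj->.
have lt_b : (b i < b (top i))%O.
  have := tracks_max Q qi (k := i).
  by rewrite lt_top leqnn /quad_sub le_top /= -ltNge; apply.
have lt_a : (a (top i) < a i)%O.
  by have := antichain lt_top; rewrite /quad_sub (ltW lt_b) andbT -ltNge.
have [] := @nearest_leftP i (top i); first by rewrite /upper_left lt_top lt_a.
set k := nearest_left i => /and3P[ki _ bik] le_ak.
have /andP[q1 q2] := tracks_in Q qi.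
have qk : in_quad k q.
  rewrite /in_quad (le_trans q1 le_ak) /=; case/andP: qi => _ /le_trans-> //.
  exact: ltW.
have le_topk : (a (top k) <= a k)%O.
  have /andP[le1 _] := tracks_mono Q qk qi (ltnW ki).
  exact: le_trans le1 le_ak.
have [|M [MD topM HM]] := IHN k _ qk le_topk; first exact: leq_trans ki iN.
have depi : depth i = (depth k).+1 by rewrite depthE -/k ki.
exists M.+1; rewrite depi ltnS iterSr -/k; split=> // -[|m] mM /=.
  by rewrite subn0 qi.
rewrite -iterS iterSr -/k; have [qm mk ->] := HM m mM.
by rewrite subSS; split=> //; apply: leq_trans mk (ltnW ki).
Qed.

(** Depth drops by one at each step, so [d] consecutive quadrants of a walk meet every residue class
    modulo [d]. With a sparse class as [S], a walk avoiding [S] takes fewer than [d] steps. *)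
Lemma walk_left_sample d : 0 < d ->
  exists (S : {set 'I_n}) (W : 'I_n -> {set 'I_n}),
    [/\ d * #|S| <= n, forall i, #|W i| <= d &
     forall q top i, tracks q top -> in_quad i q -> (a (top i) <= a i)%O ->
       (forall h : 'I_n, h <= i -> in_quad h q -> h \notin S) ->
       exists j : 'I_n, [/\ j \in W i, j <= i, in_quad j q & top j = j]].
Proof.
move=> d0.
pose F (h : 'I_n) (f : 'I_n -> nat) :=
  if nearest_left h < h then (f (nearest_left h)).+1 else 0.
have [|depth depthE] := @ord_fixpoint n nat 0 F.
  by move=> h f g fg; rewrite /F; case: ifP => // /fg->.
have [r rd Sr] := pigeonhole_mod depth d0.
exists [set i | depth i %% d == r].
exists (fun i => [set iter m nearest_left i | m : 'I_d]); split=> // [i|].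
  by apply: leq_trans (leq_imset_card _ _) _; rewrite card_ord.
move=> q top i Q qi le_top notS.
have [M [MD topM HM]] := walk_left depthE Q qi le_top.
have Md : M < d.
  rewrite ltnNge; apply/negP => dM.
  (* After [m] steps the depth is [r] modulo [d]; [d - r] stands for [- r], away from truncated
     subtraction. *)
  pose m := (depth i + (d - r)) %% d.
  have mM : m <= M by rewrite (leq_trans _ dM) // ltnW // ltn_pmod.
  have [qm mi depm] := HM m mM.
  have /negP[] := notS _ mi qm; rewrite inE depm.
  have -> : (r = r %% d) by rewrite modn_small.
  have e1 : depth i - m + (m + (d - r)) = depth i + (d - r).
    by rewrite addnA subnK // (leq_trans mM).
  have e2 : r + (m + (d - r)) = m + d.
    by rewrite addnCA subnKC // ltnW.
  by rewrite -(eqn_modDr (m + (d - r))) e1 e2 modnDr modn_mod.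
exists (iter M nearest_left i); have [qM Mi _] := HM M (leqnn M); split=> //.
by apply/imsetP; exists (Ordinal Md).
Qed.

End StaircaseWalk.

(** * Burial forest and fresh regions *)

Section Staircase.

Variables (disp : Order.disp_t) (T : orderType disp) (n : nat).
Variables (a b : 'I_n -> T).

Local Notation in_quad := (in_quad a b).
Local Notation quad_sub := (quad_sub a b).

(** The edges of the burial forest; keeping only the first quadrant that contains [j] leaves [j] at
    most one parent. *)
Definition kills (h j : 'I_n) : bool :=
  [&& j < h, quad_sub j h &
      [forall k : 'I_n, (j < k < h) ==> ~~ quad_sub j k]].

Definition fresh (h : 'I_n) (q : T * T) : bool :=
  in_quad h q && [forall k : 'I_n, (k < h) ==> ~~ in_quad k q].

(* [g.2] tells on which step of the staircase below quadrant [g.1] the point [q]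
   lies: the one delimited on its right by [c], or the rightmost one. *)
Definition step_label (g : 'I_n * option 'I_n) (q : T * T) : bool :=
  fresh g.1 q &&
  if g.2 is Some c then
    [&& kills g.1 c, (q.1 <= a c)%O &
        [forall k, kills g.1 k && (q.1 <= a k)%O ==> (a c <= a k)%O]]
  else [forall k, kills g.1 k ==> (a k < q.1)%O].

Definition steps (h : 'I_n) : {set 'I_n * option 'I_n} :=
  (h, None) |: [set (h, Some c) | c in kills h].

Lemma quad_sub_trans k j h : quad_sub j k -> quad_sub k h -> quad_sub j h.
Proof.
move=> /andP[jk1 jk2] /andP[kh1 kh2].
by rewrite /quad_sub (le_trans jk1 kh1) (le_trans jk2 kh2).
Qed.

Lemma in_quad_sub j h q : quad_sub j h -> in_quad j q -> in_quad h q.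
Proof.
move=> /andP[jh1 jh2] /andP[q1 q2].
by rewrite /in_quad (le_trans q1 jh1) (le_trans q2 jh2).
Qed.

Lemma kills_lt h j : kills h j -> j < h. Proof. by case/and3P. Qed.

Lemma kills_sub h j : kills h j -> quad_sub j h. Proof. by case/and3P. Qed.

Lemma kills_uniq h h' j : kills h j -> kills h' j -> h = h'.
Proof.
move=> /and3P[jh sjh /forallP minh] /and3P[jh' sjh' /forallP minh'].
have [lt|lt|/val_inj//] := ltngtP h h'.
  by have := minh' h; rewrite jh lt sjh.
by have := minh h'; rewrite jh' lt sjh'.
Qed.

Lemma kills_exists (j k : 'I_n) : j < k -> quad_sub j k ->
  exists2 h : 'I_n, kills h j & h <= k.
Proof.
move=> jk sjk.
have [|h /andP[jh sjh] hmin] := @arg_minnP _ k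
  (fun h : 'I_n => (j < h) && quad_sub j h) (@nat_of_ord n).
  by rewrite jk.
exists h; last by rewrite hmin ?jk.
rewrite /kills jh sjh; apply/forallP => l; apply/implyP => /andP[jl lh].
by apply: contraL lh => sjl; rewrite -leqNgt hmin ?jl.
Qed.

Lemma steps_step h q : fresh h q -> exists2 g, g \in steps h & step_label g q.
Proof.
move=> fq; have [c /andP[hc qc] | none] := pickP [pred c | kills h c & (q.1 <= a c)%O].
  have [|c' /andP[hc' qc'] cmin] := @arg_minP _ _ _ c
    (fun c => kills h c && (q.1 <= a c)%O) a; first by rewrite hc.
  exists (h, Some c'); first by rewrite !inE imset_f ?orbT.
  rewrite /step_label fq /= hc' qc' /=; apply/forallP => k; apply/implyP; exact: cmin.
exists (h, None); first by rewrite !inE eqxx.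
rewrite /step_label fq /=; apply/forallP => k; apply/implyP => hk.
by have := none k; rewrite /= hk /= leNgt => /negbFE.
Qed.

Lemma card_steps h : #|steps h| <= 1 + #|kills h|.
Proof.
rewrite /steps (leq_trans (leq_card_setU _ _)) // cards1 leq_add2l.
exact: leq_imset_card.
Qed.

Lemma sum_card_kills : \sum_h #|kills h| <= n.
Proof.
have -> : \sum_h #|kills h| = \sum_(j : 'I_n) #|[pred h | kills h j]|.
  under eq_bigr do rewrite -sum1_card big_mkcond /=.
  rewrite exchange_big /=; apply: eq_bigr => j _.
  by rewrite -sum1_card [RHS]big_mkcond.
rewrite -[X in _ <= X](card_ord n) -sum1_card; apply: leq_sum => j _.
apply/card_le1_eqP => h h' hj h'j; exact: kills_uniq h'j hj.
Qed.

(** The last quadrant before [h] that contains [k] is still exposed when [h] arrives, so [h] buries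
    it as soon as [h] contains it. *)
Lemma alive_above (h k : 'I_n) : k < h ->
  exists k' : 'I_n, [/\ k' < h, quad_sub k k' &
    forall l : 'I_n, k' < l < h -> ~~ quad_sub k' l].
Proof.
move=> kh; have [|k' /andP[k'h skk'] k'max] := @arg_maxnP _ k
  (fun l : 'I_n => (l < h) && quad_sub k l) (@nat_of_ord n).
  by rewrite kh /quad_sub !lexx.
exists k'; split=> // l /andP[k'l lh]; apply/negP => sk'l.
have := k'max l; rewrite lh (quad_sub_trans skk' sk'l) => /(_ isT) /=.
by rewrite leqNgt k'l.
Qed.

(** If [q] lay in an earlier quadrant, it would lie in an exposed one, [k]. Then [p1], left of [q]
    but outside [k], is above [k]; [p2], below [q] but outside [k], is to its right. Both lie in
    [h], so [h] buries [k], and [a k] separates [p1] from [p2], against their common label. *)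
Lemma step_convex g p1 p2 p3 p4 q :
    step_label g p1 -> step_label g p2 -> step_label g p3 -> step_label g p4 ->
    (p1.1 <= q.1)%O -> (p2.2 <= q.2)%O -> (q.1 <= p3.1)%O -> (q.2 <= p4.2)%O ->
  fresh g.1 q.
Proof.
case: g => h o; rewrite /step_label /= => /andP[f1 s1] /andP[f2 s2].
move=> /andP[/andP[/andP[p3a _] _] _] /andP[/andP[/andP[_ p4b] _] _].
move=> p1q p2q qp3 qp4.
rewrite /fresh /in_quad (le_trans qp3 p3a) (le_trans qp4 p4b) /=.
apply/forallP => k0; apply/implyP => k0h; apply/negP => qk0.
have [k [kh sk0 kmax]] := alive_above k0h.
have /andP[qka qkb] := in_quad_sub sk0 qk0.
have p1k := le_trans p1q qka; have p2k := le_trans p2q qkb.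
case/andP: f1 => /andP[_ p1h] /forallP/(_ k).
rewrite kh /= negb_and p1k /= -ltNge => kp1.
case/andP: f2 => /andP[p2h _] /forallP/(_ k).
rewrite kh /= negb_and p2k orbF -ltNge => kp2.
have hk : kills h k.
  rewrite /kills kh /quad_sub (ltW (lt_le_trans kp1 p1h)) (ltW (lt_le_trans kp2 p2h)).
  by apply/forallP => l; apply/implyP/kmax.
case: o s1 s2 => [c|] s1 s2.
  case/and3P: s1 => _ _ /forallP/(_ k); rewrite hk p1k /= => ck.
  by case/and3P: s2 => _ /le_trans/(_ ck); rewrite leNgt kp2.
by move/forallP/(_ k): s1; rewrite hk /= ltNge p1k.
Qed.

Lemma owner_exists i q : in_quad i q ->
  exists o : 'I_n, fresh o q /\ forall j, in_quad j q -> o <= j.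
Proof.
move=> qi; have [o qo omin] := @arg_minnP _ i (fun j => in_quad j q) (@nat_of_ord n) qi.
exists o; split=> //; rewrite /fresh qo; apply/forallP => k; apply/implyP.
by apply: contraL => /omin; rewrite -leqNgt.
Qed.

(** The default makes quadrants that are never buried fixed points, so burial chains are orbits. *)
Definition killer (j : 'I_n) : 'I_n := odflt j [pick h | kills h j].

Lemma killerP j : kills (killer j) j \/ killer j = j.
Proof. by rewrite /killer; case: pickP => [h hj|_]; [left|right]. Qed.

Lemma kills_killer h j : kills h j -> killer j = h.
Proof.
rewrite /killer => hj; case: pickP => [h' h'j|/(_ h)]; last by rewrite hj.
exact: kills_uniq h'j hj.
Qed.

Lemma iter_killer m (j : 'I_n) : j <= iter m killer j /\ quad_sub j (iter m killer j).
Proof.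
elim: m => [|m [IH1 IH2]]; first by rewrite /quad_sub !lexx leqnn.
rewrite iterS; have [K|->//] := killerP (iter m killer j).
split; first exact: leq_trans IH1 (ltnW (kills_lt K)).
exact: quad_sub_trans IH2 (kills_sub K).
Qed.

Lemma killer_chain_sub o u v : fconnect killer o u -> fconnect killer o v ->
  u <= v -> quad_sub u v.
Proof.
move=> /iter_findex Eu /iter_findex Ev; rewrite -Eu -Ev.
move: (findex _ _ u) (findex _ _ v) => m k; have [le|/ltnW le] := leqP m k.
  by rewrite -(subnK le) iterD; case: (iter_killer (k - m) (iter m killer o)).
rewrite -(subnK le) iterD => uv; have [vu _] := iter_killer (m - k) (iter k killer o).
have /val_inj -> : val (iter (m - k) killer (iter k killer o)) = val (iter k killer o).
  by apply/eqP; rewrite eqn_leq uv vu.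
by rewrite /quad_sub !lexx.
Qed.

Definition chain_top (o i : 'I_n) : 'I_n :=
  [arg max_(j > o | fconnect killer o j && (j <= i)) (j : nat)].

Lemma chain_topP (o i : 'I_n) : o <= i ->
  [/\ fconnect killer o (chain_top o i), chain_top o i <= i &
      forall j, fconnect killer o j -> j <= i -> j <= chain_top o i].
Proof.
move=> oi; rewrite /chain_top; case: arg_maxnP => [|j /andP[oj ji] jmax].
  by rewrite connect0.
by split=> // k ok ki; apply: jmax; rewrite ok.
Qed.

(** The burial chain of the owner is nested, so its last member up to [i] contains [q]; a quadrant
    burying that member by time [i] would prolong the chain. *)
Lemma chain_top_tracks o q : in_quad o q -> (forall j, in_quad j q -> o <= j) ->
  tracks a b q (chain_top o).
Proof.
move=> qo omin; split=> [i qi|i qi|i qi k /andP[tk ki]|i j qi qj ij].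
- by have [] := chain_topP (omin i qi).
- have [/iter_findex <- _ _] := chain_topP (omin i qi).
  by have [_ /in_quad_sub] := iter_killer (findex killer o (chain_top o i)) o; apply.
- have [oc ci cmax] := chain_topP (omin i qi).
  apply/negP => /(kills_exists tk)[h hc hk].
  have oh : fconnect killer o h.
    by apply: connect_trans oc _; rewrite -(kills_killer hc) fconnect1.
  by have := cmax h oh (leq_trans hk ki); rewrite leqNgt (kills_lt hc).
- have [oci cii cimax] := chain_topP (omin i qi).
  have [ocj cjj cjmax] := chain_topP (omin j qj).
  exact: killer_chain_sub oci ocj (cjmax _ oci (leq_trans cii ij)).
Qed.

End Staircase.

(** Exchanging the axes turns walks to the left into walks to the right. *)
Lemma tracks_swap (disp : Order.disp_t) (T : orderType disp) n (a b : 'I_n -> T) q top :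
  tracks a b q top -> tracks b a (q.2, q.1) top.
Proof.
have E i : in_quad b a i (q.2, q.1) = in_quad a b i q by rewrite /in_quad andbC.
have E' i j : quad_sub b a i j = quad_sub a b i j by rewrite /quad_sub andbC.
case=> H1 H2 H3 H4; split=> [i|i|i|i j]; rewrite !E.
- exact: H1.
- exact: H2.
- by move=> /H3 H k /H; rewrite E'.
- by rewrite E'; exact: H4.
Qed.

(** * Covering in the plane *)

(** In [4 * n], the burial forest accounts for [2 * n] and each direction of walk for [n]. In
    [2 * d ^ 2], each of two directions offers at most [d] quadrants with fewer than [d] labels
    below each. *)
Lemma planar_cover (disp : Order.disp_t) (T : orderType disp) n
    (a b : 'I_n -> T) d : 0 < d ->
    (forall i j : 'I_n, i < j -> ~~ quad_sub a b j i) ->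
  exists (S : {set 'I_n}) (G : 'I_n -> {set 'I_n * option 'I_n}),
    [/\ d * #|S| <= 4 * n, forall i, #|G i| <= 2 * d ^ 2 &
     forall i q, in_quad a b i q ->
       (forall h : 'I_n, h <= i -> in_quad a b h q -> h \notin S) ->
       exists2 g, g \in G i & step_label a b g q].
Proof.
move=> d0 anti.
have anti' (i j : 'I_n) : i < j -> ~~ quad_sub b a j i.
  by move/anti; rewrite /quad_sub andbC.
have [|acc [accE Sacc]] := @forest_cut n d (kills a b) (fun h => 1 + #|kills a b h|)
  (@kills_lt _ _ _ a b); first exact: kills_uniq.
(* Steps of [h] and those reached through light children: at most [acc h] labels. *)
pose F h (f : 'I_n -> {set 'I_n * option 'I_n}) :=
  steps a b h :|: \bigcup_(j in [set j | kills a b h j && (acc j < d)]) f j.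
have [|L LE] := @ord_fixpoint n _ set0 F.
  move=> h f g fg; congr (_ :|: _); apply: eq_bigr => j.
  by rewrite inE => /andP[/kills_lt/fg].
have cardL h : #|L h| <= acc h.
  have [N] := ubnP (h : nat); elim: N h => // N IHN h hN.
  rewrite LE accE (leq_trans (leq_card_setU _ _)) // leq_add ?card_steps //.
  apply: leq_trans (card_bigcup_le _ _) _; rewrite (eq_bigl _ _ (in_set _)).
  apply: leq_sum => j /andP[/kills_lt jh _]; apply: IHN; exact: leq_trans jh hN.
have [Sa [Wa [Sa_n Wa_d HWa]]] := walk_left_sample anti d0.
have [Sb [Wb [Sb_n Wb_d HWb]]] := walk_left_sample anti' d0.
pose V (W : {set 'I_n}) := \bigcup_(j in [set j in W | acc j < d]) L j.
have cardV (W : {set 'I_n}) : #|W| <= d -> #|V W| <= d * d.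
  move=> Wd; apply: leq_trans (card_bigcup_le _ _) _.
  apply: (@leq_trans (\sum_(j in W) d)); last by rewrite sum_nat_const leq_mul2r Wd orbT.
  rewrite big_mkcond [X in _ <= X]big_mkcond; apply: leq_sum => j _.
  by rewrite inE; case: (j \in W) => //=; case: ltnP => // /ltnW; apply: leq_trans.
exists ([set h | d <= acc h] :|: Sa :|: Sb), (fun i => V (Wa i) :|: V (Wb i)).
split=> [|i|i q qi notS].
- have wn : \sum_h (1 + #|kills a b h|) <= n + n.
    by rewrite big_split /= sum1_card card_ord leq_add2l sum_card_kills.
  apply: (@leq_trans (d * (#|[set h | d <= acc h]| + #|Sa| + #|Sb|))).
    rewrite leq_mul2l (leq_trans (leq_card_setU _ _)) ?orbT // leq_add2r.
    exact: leq_card_setU.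
  rewrite !mulnDr (_ : 4 * n = n + n + n + n); last by rewrite !mulSn addn0 !addnA.
  by rewrite !leq_add // (leq_trans Sacc).
- apply: leq_trans (leq_card_setU _ _) _; rewrite mul2n -addnn expnS expn1.
  by rewrite leq_add // cardV.
have [o [fo omin]] := owner_exists qi; have /andP[qo _] := fo.
have Q := chain_top_tracks qo omin.
have [g gs gq] := steps_step fo.
have notSacc (h : 'I_n) : h <= i -> in_quad a b h q -> acc h < d.
  by move=> hi qh; have := notS h hi qh; rewrite !inE !negb_or -ltnNge => /andP[/andP[]].
(* Along the chain from [o] up to [u], all quadrants contain [q] and are light, so its label is
   never cut off. *)
have gL u : fconnect (killer a b) o u -> u <= i -> g \in L u.
  move=> /iter_findex <-; elim: (findex _ _ _) => [|m IHm] /=.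
    by rewrite LE inE gs.
  set v := iter m _ o; have [K ki|->//] := killerP a b v.
  have vi : v <= i := leq_trans (ltnW (kills_lt K)) ki.
  have qv : in_quad a b v q.
    by have [_ /in_quad_sub] := iter_killer a b m o; apply.
  rewrite LE inE; apply/orP; right; apply/bigcupP; exists v; last exact: IHm.
  by rewrite inE K notSacc.
have gV (W : {set 'I_n}) j : j \in W -> j <= i -> in_quad a b j q ->
    chain_top a b o j = j -> g \in V W.
  move=> jW ji qj topj; apply/bigcupP; exists j; first by rewrite inE jW notSacc.
  by apply: gL ji; have [] := chain_topP a b (omin j qj); rewrite topj.
exists g => //; rewrite inE; have [le_a|lt_a] := leP (a (chain_top a b o i)) (a i).
  have [h hi qh|j [jW ji qj topj]] := HWa _ _ _ Q qi le_a.
    by have := notS h hi qh; rewrite !inE !negb_or => /andP[/andP[]].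
  by rewrite (gV _ _ jW).
(* By the antichain, an earlier quadrant reaching further right than [i] reaches less far up: the
   mirrored walk applies. *)
have le_b : (b (chain_top a b o i) <= b i)%O.
  have [|topi] := ltnP (chain_top a b o i) i.
    move=> /anti; rewrite /quad_sub (ltW lt_a) /= -ltNge; exact: ltW.
  have /val_inj <- // : val i = val (chain_top a b o i).
  by apply/eqP; rewrite eqn_leq topi (tracks_le Q qi).
have [|h hi|j [jW ji]] := HWb _ _ _ (tracks_swap Q) _ le_b.
- by rewrite /in_quad andbC.
- rewrite /in_quad andbC => qh.
  by have := notS h hi qh; rewrite !inE !negb_or => /andP[].
rewrite /in_quad andbC => qj topj; by rewrite (gV _ _ jW) ?orbT.
Qed.

(** * Cells, bounding boxes and counting *)

Local Open Scope fset_scope.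
Local Open Scope ring_scope.

Lemma card_fset_filter (T : choiceType) (P : {fset T}) (Q : pred T) :
  #|` [fset p in P | Q p]| = (\sum_(p <- P) Q p)%N.
Proof.
rewrite card_fset_sum1 big_fset /= big_mkcond /=.
by apply: eq_bigr => p _; case: (Q p).
Qed.

Lemma exists_min_seq (T : eqType) (R : realDomainType) (f : T -> R) (s : seq T) :
  s != [::] -> exists2 p, p \in s & forall q, q \in s -> f p <= f q.
Proof.
elim: s => // x [|y s] IH _.
  by exists x; rewrite ?mem_head // => q; rewrite inE => /eqP->.
have [//|p ps pmin] := IH; have [le_xp|/ltW le_px] := leP (f x) (f p).
  exists x; first exact: mem_head.
  move=> q; rewrite inE => /orP[/eqP->//|/pmin]; exact: le_trans.
exists p; first by rewrite inE ps orbT.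
by move=> q; rewrite inE => /orP[/eqP->|/pmin].
Qed.

Definition upper (R : realType) (I : interval R) : itv_bound R :=
  let: Interval _ u := I in u.

(** Coordinates become right endpoints, comparable with upper ends of cells that may be infinite. *)
Definition xy (R : realType) (p : point R) : itv_bound R * itv_bound R :=
  (BRight p.1.1, BRight p.1.2).

(** This is inclusion for cells, whose lower ends are all 0. *)
Definition box_le (R : realType) (B B' : box R) : bool :=
  [&& (upper B.1.1 <= upper B'.1.1)%O, (upper B.1.2 <= upper B'.1.2)%O &
      (upper B.2 <= upper B'.2)%O].

Lemma anchoredE (R : realType) (I : interval R) :
  anchored I -> I = Interval (BLeft 0) (upper I).
Proof. by case=> [->|[a _ ->]]. Qed.

Lemma anchored_mem (R : realType) (I : interval R) (x : R) : anchored I ->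
  (x \in I) = (0 <= x) && (BRight x <= upper I)%O.
Proof. by move/anchoredE->; rewrite itv_boundlr. Qed.

Lemma in_cell (R : realType) (B : box R) (p : point R) : is_cell B ->
  in_box B p = [&& 0 <= p.1.1, 0 <= p.1.2, 0 <= p.2,
    (BRight p.1.1 <= upper B.1.1)%O, (BRight p.1.2 <= upper B.1.2)%O &
    (BRight p.2 <= upper B.2)%O].
Proof.
case=> hx hy hz; rewrite /in_box !anchored_mem //.
by do !case: (_ <= _)%R => //=; rewrite ?andbF //.
Qed.

Lemma cell_le_anti (R : realType) (B B' : box R) : is_cell B -> is_cell B' ->
  box_le B B' -> box_le B' B -> B = B'.
Proof.
case: B B' => [[X Y] Z] [[X' Y'] Z'] [/= hX hY hZ] [/= hX' hY' hZ'].
move=> /and3P[/= lX lY lZ] /and3P[/= lX' lY' lZ'].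
rewrite (anchoredE hX) (anchoredE hY) (anchoredE hZ).
rewrite (anchoredE hX') (anchoredE hY') (anchoredE hZ').
by congr (Interval _ _, Interval _ _, Interval _ _); apply: le_anti; apply/andP.
Qed.

Lemma box_le_trans (R : realType) (B2 B1 B3 : box R) :
  box_le B1 B2 -> box_le B2 B3 -> box_le B1 B3.
Proof.
move=> /and3P[x y z] /and3P[x' y' z'].
by rewrite /box_le (le_trans x x') (le_trans y y') (le_trans z z').
Qed.

Definition maximal_cell (R : realType) (C : {fset box R}) (M : box R) : bool :=
  all (fun B => box_le M B ==> (B == M)) C.

Lemma exists_maximal_cell (R : realType) (C : {fset box R}) (B : box R) :
    (forall B, B \in C -> is_cell B) -> B \in C ->
  exists2 M, (M \in C) && maximal_cell C M & box_le B M.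
Proof.
move=> cellC; have [N] := ubnP #|` [fset B' in C | box_le B B']|.
elim: N B => // N IHN B; rewrite ltnS => BN BC.
have [Bmax|] := boolP (maximal_cell C B).
  by exists B; rewrite ?BC // /box_le !lexx.
case/allPn => B' B'C; rewrite negb_imply => /andP[leBB' neq].
have [|//|M MC leM] := IHN B'.
  apply: leq_trans BN; apply: fproper_ltn_card; rewrite fproperE.
  apply/andP; split; first apply/fsubsetP => B2.
    by rewrite !inE => /andP[-> /=]; exact: box_le_trans.
  apply/negP => /fsubsetP/(_ B); rewrite !inE BC /box_le !lexx => /(_ isT) leB'B.
  by rewrite (cell_le_anti (cellC _ BC) (cellC _ B'C)) ?eqxx in neq.
by exists M => //; exact: box_le_trans leBB' leM.
Qed.

Lemma hull_box (R : realType) (s : seq (point R)) :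
  exists2 B : box R, z_unbounded B &
    (forall p, p \in s -> in_box B p) /\
    (s != [::] -> exists p1 p2 p3 p4 : point R,
       [/\ p1 \in s, p2 \in s, p3 \in s & p4 \in s] /\
       forall q, in_box B q ->
         [/\ p1.1.1 <= q.1.1, p2.1.2 <= q.1.2, q.1.1 <= p3.1.1 & q.1.2 <= p4.1.2]).
Proof.
have [->|s0] := eqVneq s [::].
  by exists (`[0, 0], `[0, 0], `]-oo, +oo[) => //; exists 0, 0, 0, 0.
have [p1 s1 m1] := exists_min_seq (fun p : point R => p.1.1) s0.
have [p2 s2 m2] := exists_min_seq (fun p : point R => p.1.2) s0.
have [p3 s3 m3] := exists_min_seq (fun p : point R => - p.1.1) s0.
have [p4 s4 m4] := exists_min_seq (fun p : point R => - p.1.2) s0.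
exists (`[p1.1.1, p3.1.1], `[p2.1.2, p4.1.2], `]-oo, +oo[).
  by exists p1.1.1, p3.1.1, p2.1.2, p4.1.2; rewrite m1 // m2.
split=> [p ps | _].
  by rewrite /in_box !in_itv /= m1 // m2 //= -lerN2 m3 //= -lerN2 m4.
exists p1, p2, p3, p4; split=> // q.
by rewrite /in_box !in_itv /= => /and3P[/andP[-> ->] /andP[-> ->] _].
Qed.

Lemma card_fset_exists (T : choiceType) (I : finType) (P : {fset T})
    (S : {set I}) (Q : I -> pred T) :
  (#|` [fset p in P | [exists h in S, Q h p]]|
     <= \sum_(h in S) #|` [fset p in P | Q h p]|)%N.
Proof.
rewrite card_fset_filter; rewrite (eq_bigr _ (fun h _ => card_fset_filter P (Q h))).
rewrite exchange_big /=; apply: leq_sum => p _.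
case: existsP => // -[h /andP[hS Qhp]]; by rewrite (bigD1 h) //= Qhp.
Qed.

Lemma sum_card_fset_disjoint (T : choiceType) (I : finType) (P : {fset T})
    (S : {set I}) (Q : I -> pred T) :
    (forall p h h', Q h p -> Q h' p -> h = h') ->
  (\sum_(h in S) #|` [fset p in P | Q h p]| <= #|` P|)%N.
Proof.
move=> Quniq; rewrite (eq_bigr _ (fun h _ => card_fset_filter P (Q h))).
rewrite exchange_big card_fset_sum1 /=; apply: leq_sum => p _.
have [h /andP[hS Qhp]|none] := pickP [pred h | (h \in S) && Q h p].
  rewrite (bigD1 h) //= Qhp big1 // => h' /andP[_ hh'].
  by apply/eqP; rewrite eqb0; apply: contra hh' => /Quniq/(_ Qhp)->.
by rewrite big1 // => h hS; have := none h; rewrite /= hS /= => ->.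
Qed.

Lemma fresh_uniq (disp : Order.disp_t) (T : orderType disp) n
    (a b : 'I_n -> T) q h h' :
  fresh a b h q -> fresh a b h' q -> h = h'.
Proof.
move=> /andP[qh /forallP nh] /andP[qh' /forallP nh'].
have [lt|lt|/val_inj//] := ltngtP h h'.
  by have := nh' h; rewrite lt qh.
by have := nh h'; rewrite lt qh'.
Qed.

(** At most [4 k m / (t d)] sampled cells and [m / (t d)] overfull ones, each with at most [2 t]
    points. *)
Lemma dropped_bound (R : realType) (k t : R) (m n d s sD : nat) :
    0 < t -> (0 < d)%N -> n%:R <= k * (m%:R / t) -> (d * s <= 4 * n)%N ->
    sD%:R * (t * d%:R) <= m%:R ->
  (s + sD)%:R * (2 * t) <= (8 * k + 2) * (m%:R / d%:R).
Proof.
move=> t0 d0 nk ds sDm.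
have d0' : 0 < d%:R :> R by rewrite ltr0n.
have {}nk : t * n%:R <= k * m%:R.
  by rewrite mulrC -ler_pdivlMr // -mulrA.
have {}ds : t * (d%:R * s%:R) <= t * (4 * n%:R) :> R.
  by rewrite ler_pM2l // -!natrM ler_nat.
rewrite [leRHS]mulrA ler_pdivlMr // natrD; lra.
Qed.

(** * From quadrants back to cells *)

Theorem theorem2 (R : realType) (k : R) :
  exists Ka Kc Kd : R,
  forall (m : nat) (P : {fset point R}) (t : R) (C : {fset box R}) (d : nat),
    #|` P| = m -> 0 < t -> shallow_cutting k t P C -> (0 < d)%N ->
  exists (P' : {fset point R}) (Rs : {fset box R}),
    P' `<=` P /\
    [/\ #|` P'|%:R <= Ka * (m%:R / d%:R),
        forall B : box R, B \in Rs -> z_unbounded B,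
        forall Ci : box R, Ci \in C ->
          exists G : {fset box R},
            [/\ G `<=` Rs,
                #|` G|%:R <= Kc * d%:R ^+ 3
              & conflict_list P Ci `&` (P `\` P') `<=`
                \bigcup_(B <- G) (conflict_list P Ci `&` box_points P B)]
      & forall B : box R, B \in Rs -> #|` box_points P B|%:R <= Kd * (t * d%:R ^+ 4)].
Proof.
(* The last two constants come from [2 d^2 <= 2 d^3] and [t d <= t d^4]. *)
exists (8 * k + 2), 2, 1 => m P t C d Pm t0 [Ccard cellC listC _] d0.
have d1 : 1 <= d%:R :> R by rewrite ler1n.
pose higher (B B' : box R) := (upper B'.2 <= upper B.2)%O.
pose s := sort higher [seq B <- C | maximal_cell C B].
pose n := size s; pose B0 : box R := (`[0, 0], `[0, 0], `[0, 0]).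
pose cell (i : 'I_n) := nth B0 s i.
have sP B : (B \in s) = (B \in C) && maximal_cell C B.
  by rewrite mem_sort mem_filter andbC.
have cell_s i : cell i \in s by apply: mem_nth.
have cell_C i : cell i \in C by have := cell_s i; rewrite sP => /andP[].
have cell_desc (i j : 'I_n) : (i <= j)%N -> (upper (cell j).2 <= upper (cell i).2)%O.
  have higher_tr : transitive higher by move=> B2 B1 B3 le12 le23; exact: le_trans le23 le12.
  have higher_total : total higher by move=> B1 B2; exact: le_total.
  have := sorted_leq_nth higher_tr _ B0 (sort_sorted higher_total _).
  by move/(_ (fun=> lexx _) _ i j); apply; rewrite ?inE.
have n_C : (n <= #|` C|)%N by rewrite /n size_sort size_filter count_size.
pose a i := upper (cell i).1.1; pose b i := upper (cell i).1.2.
have anti (i j : 'I_n) : (i < j)%N -> ~~ quad_sub a b j i.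
  (* Cell [i] is at least as high as cell [j]; containing its quadrant, it would contain cell [j],
     against maximality. *)
  move=> ij; apply/negP => /andP[le_a le_b].
  have := cell_s j; rewrite sP => /andP[_ /allP/(_ _ (cell_C i))].
  rewrite /box_le le_a le_b cell_desc ?(ltnW ij) //=.
  rewrite nth_uniq ?sort_uniq ?filter_uniq //; last exact: fset_uniq.
  by rewrite ltn_eqF.
have [S [G [S_n G_d coverS]]] := planar_cover d0 anti.
pose D h := [fset p in P | fresh a b h (xy p)].
pose SD := [set h | t * d%:R < #|` D h|%:R].
pose P' := [fset p in P | [exists h in S :|: SD, in_box (cell h) p]].
have inD h p : (p \in D h) = (p \in P) && fresh a b h (xy p) by rewrite !inE.
pose Q g := [seq p <- P | step_label a b g (xy p)].
have QP g p : (p \in Q g) = step_label a b g (xy p) && (p \in P).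
  by rewrite mem_filter.
have /fin_all_exists[box_ boxP] (g : 'I_n * option 'I_n) : exists B : box R,
    [/\ z_unbounded B, forall p, p \in Q g -> in_box B p &
        Q g != [::] -> box_points P B `<=` D g.1].
  have [B zB [QB hullB]] := hull_box (Q g).
  exists B; split=> // /hullB[p1 [p2 [p3 [p4 [[]]]]]].
  rewrite !QP => /andP[l1 _] /andP[l2 _] /andP[l3 _] /andP[l4 _] hull.
  apply/fsubsetP => q; rewrite !inE => /andP[-> /hull[q1 q2 q3 q4]] /=.
  exact: (step_convex l1 l2 l3 l4).
(* The box of a label without points is arbitrary and could hold too many points of [P]. *)
pose good g := (Q g != [::]) && (g.1 \notin SD).
pose Rs := [fset box_ g | g in [set g | good g]].
exists P', Rs; split; first by apply/fsubsetP => p; rewrite !inE => /andP[].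
split.
- have leS : #|` P'|%:R <= (#|S| + #|SD|)%:R * (2 * t).
    apply: (@le_trans _ _ (\sum_(h in S :|: SD) #|` box_points P (cell h)|)%:R).
      by rewrite ler_nat; exact: card_fset_exists.
    apply: (@le_trans _ _ (\sum_(h in S :|: SD) (2 * t))).
      by rewrite natr_sum; apply: ler_sum => h _; exact: listC.
    rewrite sumr_const -[leLHS]mulr_natl ler_wpM2r ?mulr_ge0 ?(ltW t0) // ler_nat.
    exact: leq_card_setU.
  apply: le_trans leS _; apply: dropped_bound S_n _ => //.
    by apply: le_trans (_ : #|` C|%:R <= _); rewrite ?ler_nat // -Pm.
  rewrite -Pm; apply: (@le_trans _ _ (\sum_(h in SD) #|` D h|)%:R); last first.
    rewrite ler_nat; apply: sum_card_fset_disjoint => p h h'; exact: fresh_uniq.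
  rewrite mulr_natl -sumr_const natr_sum; apply: ler_sum => h.
  by rewrite inE => /ltW.
- by move=> B /imfsetP[g _ ->]; have [] := boxP g.
(* The boxes of a maximal cell containing [Ci] also serve [Ci]. *)
- move=> Ci CiC; have [M MC leM] := exists_maximal_cell cellC CiC.
  have [M_C _] := andP MC.
  have Ms : M \in s by rewrite sP.
  have Mn : (index M s < n)%N by rewrite index_mem.
  pose i := Ordinal Mn; have cell_i : cell i = M by apply: nth_index.
  exists [fset box_ g | g in [set g in G i | good g]]; split.
  + apply/fsubsetP => B /imfsetP[g]; rewrite /= inE => /andP[_ gg] ->.
    by apply/imfsetP; exists g => //; rewrite /= inE.
  + apply: (@le_trans _ _ (2 * d ^ 2)%:R); last first.
      by rewrite natrM natrX ler_pM2l // ler_weXn2l.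
    rewrite ler_nat (leq_trans (leq_imfset_card _ _ _)) //.
    apply: leq_trans (G_d i); rewrite -cardE; apply: subset_leq_card.
    by apply/subsetP => g; rewrite inE => /andP[].
  + apply/fsubsetP => p; rewrite !inE => /andP[/andP[pP pCi] /andP[notP' _]].
    have := pCi; rewrite (in_cell _ (cellC _ CiC)) => /and5P[x0 y0 z0 px /andP[py pz]].
    have /and3P[leMx leMy leMz] := leM.
    have pz_i : (BRight p.2 <= upper (cell i).2)%O by rewrite cell_i (le_trans pz).
    have qi : in_quad a b i (xy p).
      by rewrite /in_quad /a /b cell_i (le_trans px) ?(le_trans py).
    (* Cell [h] is at least as high as cell [i], so it contains [p]; dropping it would put [p] in
       [P']. *)
    have undropped (h : 'I_n) : (h <= i)%N -> in_quad a b h (xy p) ->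
        h \notin S :|: SD.
      move=> hi /andP[ph1 ph2]; apply: contra notP' => hS; rewrite pP /=.
      apply/existsP; exists h; rewrite hS (in_cell _ (cellC _ (cell_C h))) x0 y0 z0.
      by rewrite ph1 ph2 (le_trans pz_i) // cell_desc.
    have [|g gG gp] := coverS i (xy p) qi.
      by move=> h hi qh; have := undropped h hi qh; rewrite inE negb_or => /andP[].
    have pQ : p \in Q g by rewrite QP gp.
    have gSD : g.1 \notin SD.
      have /andP[/andP[qg /forallP first_g] _] := gp.
      have gi : (g.1 <= i)%N.
        by rewrite leqNgt; apply/negP => ig; have := first_g i; rewrite ig qi.
      by have := undropped _ gi qg; rewrite inE negb_or => /andP[].
    have [_ /(_ _ pQ) pB _] := boxP g.
    apply/bigfcupP; exists (box_ g); last by rewrite !inE pP pCi pB.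
    rewrite andbT; apply/imfsetP; exists g => //; rewrite /= inE gG /good gSD andbT.
    by case: (Q g) pQ.
- move=> B /imfsetP[g]; rewrite /= inE => /andP[Qg gSD] ->.
  have [_ _ /(_ Qg)/fsubset_leq_card BD] := boxP g.
  have := gSD; rewrite inE -leNgt => Dle; rewrite mul1r.
  apply: le_trans (_ : #|` D g.1|%:R <= _); first by rewrite ler_nat.
  by apply: le_trans Dle _; rewrite ler_pM2l // ler_eXnr.
Qed.
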